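(* The $\sigma$-ideal $\mathcal{M}_-$ is not $\mathrm{add}(\mathcal{M})$-cc.
   Context: $\mathcal{M}$ is the $\sigma$-ideal of meager subsets of $\omega^\omega$, and $\mathrm{add}(\mathcal{M})=\min\{|\mathcal{A}|:\mathcal{A}\subseteq\mathcal{M}\wedge\bigcup\mathcal{A}\notin\mathcal{M}\}$. $\forall^\infty n$ means ''for all but finitely many $n\in\omega$''. A set $F\subseteq\omega^\omega$ belongs to $\mathcal{M}_-$ if there are $x_F\in\omega^\omega$ and a partition $(I_n)_{n\in\omega}$ of $\omega$ into (nonempty, finite) intervals such that $F\subseteq\{x\in\omega^\omega:(\forall^\infty n)(x\upharpoonright I_n\neq x_F\upharpoonright I_n)\}$; $\mathcal{M}_-$ is known to be a $\sigma$-ideal. A $\sigma$-ideal $\mathcal{I}$ of subsets of $\omega^\omega$ is $\kappa$-cc (for a cardinal $\kappa$) if for every family $\{A_\alpha:\alpha<\kappa\}$ of Borel sets not belonging to $\mathcal{I}$ there are $\alpha\neq\beta$ such that $A_\alpha\cap A_\beta\notin\mathcal{I}$. *)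

(* Defs.v *)
From mathcomp Require Import all_boot all_order all_algebra.
From mathcomp Require Import all_classical all_reals all_analysis.

Set Implicit Arguments.
Unset Strict Implicit.
Unset Printing Implicit Defensive.

Local Open Scope classical_set_scope.
Local Open Scope card_scope.

(* The product topology, each factor [nat] being discrete. *)
Notation baire_space := {ptws nat -> nat}.

Definition borel (T : topologicalType) : set (set T) := <<s [set U : set T | open U] >>.

Definition nowhere_dense (T : topologicalType) (A : set T) : Prop :=
  (closure A)° = set0.

Definition meager (T : topologicalType) : set (set T) :=
  [set A | exists2 F : (set T)^nat,
     (forall n, nowhere_dense (F n)) & A = \bigcup_n F n].

Definition interval_partition (I : (set nat)^nat) : Prop :=
  partition [set: nat] I [set: nat] /\
  forall n, exists a b : nat, I n = [set k | (a <= k < b)%N].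

Definition meager_minus : set (set baire_space) :=
  [set F | exists xF : baire_space, exists2 I : (set nat)^nat,
     interval_partition I &
     F `<=` [set x : baire_space | \forall n \near \oo, ~ {in I n, x =1 xF}]].

(* Cardinals are represented by sets [kappa], up to the equipotence [#=]. *)

Definition add_family (X : Type) (J : set (set X)) (A : set (set X)) : Prop :=
  A `<=` J /\ ~ J (\bigcup_(S in A) S).

(* [kappa] has cardinality add(J), the least cardinality of an [add_family]. *)
Definition is_add (X : Type) (J : set (set X)) (T : Type) (kappa : set T) : Prop :=
  (exists2 A, add_family J A & kappa #= A) /\
  (forall A, add_family J A -> kappa #<= A).

Definition cc (X : topologicalType) (T : Type) (kappa : set T)
    (J : set (set X)) : Prop :=
  forall A : T -> set X,
    (forall i, kappa i -> borel (A i) /\ ~ J (A i)) ->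
    exists i j, [/\ kappa i, kappa j, i <> j & ~ J (A i `&` A j)].

(* The cardinal add(M) exists: cardinals are well-founded, and the singletons
   form an [add_family] by the Baire category theorem. *)

Lemma min_card_exists (T : pointedType) (W : set (set T)) : W !=set0 ->
  exists2 A, W A & forall B, W B -> A #<= B.
Proof.
move=> [W0 WW0].
pose P (S : set (set T -> T)) :=
  (forall f B, S f -> W B -> B (f B)) /\
  (forall f g B, S f -> S g -> W B -> f B = g B -> f = g).
have [F FP totF|S [[SB Sinj] Smax]] := @Zorn_bigcup _ P.
  split=> [f B [S FS Sf] WB|f g B [S FS Sf] [S' FS' Sg] WB fg].
    by have [+ _] := FP _ FS => /(_ f B Sf WB).
  have [SS'|S'S] := totF _ _ FS FS'.
    by have [_ +] := FP _ FS' => /(_ f g B (SS' _ Sf) Sg WB fg).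
  by have [_ +] := FP _ FS => /(_ f g B Sf (S'S _ Sg) WB fg).
have [[A WA Asurj]|noA] :=
    pselect (exists2 A, W A & forall t, A t -> exists2 f, S f & f A = t).
  exists A => // B WB.
  have /choice[phi phiP] : forall t, exists f, A t -> S f /\ f A = t.
    move=> t; have [/Asurj[f Sf fA]|nAt] := pselect (A t); first by exists f.
    by exists (fun=> point).
  apply/pcard_leP/injfunPex; exists (fun t => phi t B) => [t /phiP[St _]|t u].
    by move/SB: St => /(_ B WB).
  move=> /set_mem/phiP[St tE] /set_mem/phiP[Su uE] tu.
  by rewrite -tE -uE (Sinj _ _ _ St Su WB tu).
have /choice[h hP] : forall B, exists t, W B -> B t /\ forall f, S f -> f B <> t.
  move=> B; have [WB|nWB] := pselect (W B); last by exists point.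
  apply: contrapT => /forallNP nt; apply: noA; exists B => // t Bt.
  apply: contrapT => nf; apply: (nt t) => _; split=> // f Sf fB.
  by apply: nf; exists f.
exfalso; apply: (Smax (S `|` [set h])).
  split; first by move=> f Sf; left.
  move=> /(_ h (or_intror erefl)) Sh.
  by have [_ /(_ _ Sh)] := hP _ WW0.
split=> [f B [Sf|->] WB|f g B [Sf|->] [Sg|->] WB fg //].
- by move/SB: Sf => /(_ B WB).
- by have [] := hP _ WB.
- exact: Sinj Sf Sg WB fg.
- by have [_ /(_ _ Sf)] := hP _ WB.
- by have [_ /(_ _ Sg)] := hP _ WB; rewrite fg.
Qed.

Lemma cylinder_nbhs (x : baire_space) (m : nat) :
  nbhs x [set y : baire_space | forall i, (i < m)%N -> y i = x i].
Proof.
elim: m => [|m IHm]; first by apply: filterS filterT.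
have nm : nbhs x [set y : baire_space | y m = x m].
  have := @proj_continuous nat (fun=> nat) m x [set x m].
  by apply; exact: discrete_set1.
apply: filterS2 IHm nm => y ylt ym i; rewrite ltnS leq_eqVlt => /orP[/eqP->//|].
exact: ylt.
Qed.

Lemma nbhs_cylinder (x : baire_space) (U : set baire_space) : nbhs x U ->
  exists m, forall y : baire_space, (forall i, (i < m)%N -> y i = x i) -> U y.
Proof.
move=> xU; apply: contrapT => /forallNP nU.
have /choice[y yP] : forall m, exists y : baire_space,
    (forall i, (i < m)%N -> y i = x i) /\ ~ U y.
  move=> m; have /existsNP[y /not_implyP[? ?]] := nU m.
  by exists y.
have yx : y @ \oo --> x.
  apply/pointwise_cvgP => i V /nbhs_singleton Vx.
  by exists i.+1 => // n /= ni; rewrite (proj1 (yP n)).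
have [N _ /(_ N (leqnn N))] := yx _ xU.
by have [_] := yP N.
Qed.

Lemma baire_space_nonmeager : ~ meager [set: baire_space].
Proof.
move=> [F nd FT].
have step (np : nat * (baire_space * nat)) : exists q : baire_space * nat,
    [/\ (np.2.2 < q.2)%N, forall i, (i < np.2.2)%N -> q.1 i = np.2.1 i &
     forall y : baire_space, (forall i, (i < q.2)%N -> y i = q.1 i) -> ~ F np.1 y].
  case: np => n [x m] /=.
  have [z zx ncz] : exists2 z : baire_space,
      (forall i, (i < m)%N -> z i = x i) & ~ closure (F n) z.
    apply: contrapT => nz.
    suff : (closure (F n))° x by rewrite (nd n).
    apply: filterS (cylinder_nbhs x m) => z zx.
    by apply: contrapT => ncz; apply: nz; exists z.
  have /existsNP[U /not_implyP[zU /set0P/negP/negPn/eqP FU0]] := ncz.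
  have [k kU] := nbhs_cylinder zU.
  exists (z, maxn m.+1 k); split=> //=; first by rewrite leq_max ltnSn.
  move=> y yz Fy; suff : (F n `&` U) y by rewrite FU0.
  by split=> //; apply: kU => i ik; apply: yz; rewrite leq_max ik orbT.
have [g gP] := choice step.
pose p := fix p n := if n is k.+1 then g (k, p k) else ((fun=> 0%N) : baire_space, 0%N).
have plt n : (n <= (p n).2)%N.
  by elim: n => // n IHn; have [/= lt _ _] := gP (n, p n); exact: leq_ltn_trans lt.
have pmono n j i : (i < (p n).2)%N ->
    (i < (p (n + j)%N).2)%N /\ (p (n + j)%N).1 i = (p n).1 i.
  move=> ni; elim: j => [|j [lt e]]; first by rewrite addn0.
  rewrite addnS; have [/= lt' e' _] := gP ((n + j)%N, p (n + j)%N).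
  by split; [exact: ltn_trans lt' | rewrite e' // e].
pose y : baire_space := fun i => (p i.+1).1 i.
have [n _ Fy] : (\bigcup_n F n) y by rewrite -FT.
have [_ _ /(_ y) /=] := gP (n, p n); apply => // i ilt.
have ilt' : (i < (p n.+1).2)%N by [].
have [_ <-] := pmono n.+1 i.+1 i ilt'.
have [_] := pmono i.+1 n.+1 i (plt i.+1).
by rewrite /y addnC => ->.
Qed.

Lemma add_meager_exists :
  exists A : set (set baire_space), is_add (@meager baire_space) A.
Proof.
have [|A WA Amin] := @min_card_exists _ (add_family (@meager baire_space)).
  exists (range (@set1 baire_space)); split.
    move=> _ [x _ <-]; exists (fun=> [set x]); last by rewrite bigcup_const.
    move=> _; apply/seteqP; split=> // z zx.
    have [m mx] := nbhs_cylinder zx.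
    pose y (c : nat) : baire_space := fun i => if (i < m)%N then z i else c.
    have yx c : y c = x.
      have cx : closure [set x] (y c) by apply: mx => i im; rewrite /y im.
      apply/funext => i; have [_ [-> e]] := cx _ (cylinder_nbhs (y c) i.+1).
      by rewrite e.
    have : y 0%N m = y 1%N m by rewrite !yx.
    by rewrite /y ltnn.
  rewrite (_ : \bigcup_(S in _) S = setT); first exact: baire_space_nonmeager.
  by apply/seteqP; split=> // x _; exists [set x] => //; exists x.
by exists A; split=> //; exists A.
Qed.

(* Main.v *)
Require Import Defs.
From mathcomp Require Import all_boot all_order all_algebra.
From mathcomp Require Import all_classical all_reals all_analysis.

Local Open Scope classical_set_scope.

(** The ideal [meager_minus] even has an antichain of continuum many closed
sets, and [add(M)] is at most the continuum because the singletons form a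
family of meager sets with nonmeager union ([kappa_le_continuum]).

The antichain is [record_set f], for [f] in the Baire space.  A position [n] is
a record of [x] when [x n] exceeds all earlier values.  A point of
[record_set f] must, at every record [n], have a value that encodes the first
[n] values of [f]; elsewhere it is free.
- If [f] and [g] differ at [i], a point of both sets has no record after [i], so
  it is bounded, and the bounded points form a set in [meager_minus], since they
  differ from the identity at every large coordinate
  ([record_setI_meager_minus]).
- One huge value placed just before an interval prevents any record inside it.
  So a point of [record_set f] may copy a given [y] on infinitely many intervals
  of a given partition, as long as each of them is preceded by a position where
  a value encoding a piece of [f] can be put; this needs only that the chosen
  intervals are not adjacent.  Hence [record_set f] is not in [meager_minus]
  ([record_set_not_meager_minus]). *)

(** The head of the decoded list carries no information about [f]: it is a
padding that makes arbitrarily large codes available ([code_record_large]). *)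
Definition record_set (f : baire_space) : set baire_space :=
  [set x | forall n, behead (CodeSeq.decode (x n)) = mkseq f n \/
                     exists2 i, (i < n)%N & (x n <= x i)%N].

Lemma code_record_large (s : seq nat) (B : nat) :
  exists2 v, behead (CodeSeq.decode v) = s & (B <= v)%N.
Proof.
exists (CodeSeq.code (B :: s)); first by rewrite CodeSeq.codeK.
have := CodeSeq.gtn_decode (CodeSeq.code (B :: s)).
by rewrite CodeSeq.codeK /= => /andP[/ltnW].
Qed.

(** Whether the condition fails at [n] depends only on the first [n + 1]
coordinates, so the complement is open. *)
Lemma borel_record_set (f : baire_space) : borel (record_set f).
Proof.
rewrite -(setCK (record_set f)) -setTD; apply: sigma_algebraCD.
apply: sub_sigma_algebra => /=; rewrite openE => x /existsNP[n xn].
apply: filterS (cylinder_nbhs x n.+1) => y yx yf; apply: xn.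
have := yf n; rewrite yx // => -[|[i lt_in]]; first by left.
by rewrite yx; [right; exists i | exact: ltnW].
Qed.

Lemma record_setI_bounded (f g x : baire_space) :
  f <> g -> record_set f x -> record_set g x -> exists M, forall n, (x n <= M)%N.
Proof.
move=> fg fx gx.
have [i fgi] : exists i, f i <> g i.
  by apply: contrapT => /forallNP fgE; apply: fg; apply/funext => i;
    apply: contrapT.
exists (\max_(j < i.+1) x j); elim/ltn_ind => n IHn.
have [ni|lt_in] := ltnP n i.+1; first exact: (leq_bigmax (Ordinal ni)).
have [fn|[j jn le_nj]] := fx n; last exact: leq_trans le_nj (IHn j jn).
have [gn|[j jn le_nj]] := gx n; last exact: leq_trans le_nj (IHn j jn).
by case: fgi; rewrite -(nth_mkseq 0%N f lt_in) -fn gn nth_mkseq.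
Qed.

Lemma interval_partition1 : interval_partition (fun n => [set n]).
Proof.
split=> [|n].
  split=> [||n _]; last by exists n.
  - by apply/seteqP; split=> // n _; exists n.
  - by move=> i j _ _ [k [-> ->]].
exists n, n.+1; apply/seteqP; split=> k /=; first by move=> ->; rewrite leqnn /=.
by rewrite ltnS -eqn_leq => /eqP.
Qed.

Lemma record_setI_meager_minus (f g : baire_space) :
  f <> g -> meager_minus (record_set f `&` record_set g).
Proof.
move=> fg; exists (id : baire_space), (fun n => [set n]).
  exact: interval_partition1.
move=> x [fx gx]; have [M xM] := record_setI_bounded _ _ _ fg fx gx.
exists M.+1 => // n /= Mn /(_ n); rewrite inE => /(_ erefl) xn.
by have := xM n; rewrite xn leqNgt Mn.
Qed.

(** The enumeration of a partition need not follow the order of its blocks, so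
late blocks must be found: a block that contains a far position is different
from the first [N] ones, and the block right after it is too, and starts far. *)
Lemma interval_partition_late (I : (set nat)^nat) (N : nat) :
  interval_partition I ->
  exists n a b, [/\ (N <= n)%N, (N <= a)%N, (a < b)%N &
                    I n = [set k | (a <= k < b)%N]].
Proof.
move=> [[cov triv ne] int].
have /choice[b bP] n : exists b, exists a, I n = [set k | (a <= k < b)%N].
  by have [a [b E]] := int n; exists b, a.
pose p0 := maxn N (\max_(j < N) b j).
have late p n : (p0 <= p)%N -> I n p -> (N <= n)%N.
  move=> p0p Inp; rewrite leqNgt; apply/negP => nN.
  have [a E] := bP n; move: Inp; rewrite E /= => /andP[_].
  rewrite ltnNge => /negP; apply; apply: leq_trans p0p.
  by rewrite leq_max (leq_bigmax (Ordinal nN)) orbT.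
have block p : exists n, I n p.
  by have : [set: nat] p by []; rewrite -cov => -[n _ Inp]; exists n.
have [n Inp] := block p0; have [a E] := bP n.
have [a_p0 p0_b] : (a <= p0)%N /\ (p0 < b n)%N by move: Inp; rewrite E => /andP.
have [n' In'p] := block (b n); have [a' E'] := bP n'.
have [a'_b b_b'] : (a' <= b n)%N /\ (b n < b n')%N.
  by move: In'p; rewrite E' => /andP.
exists n', a', (b n'); split=> //; last exact: leq_ltn_trans b_b'.
  exact: late (ltnW p0_b) In'p.
rewrite leqNgt; apply/negP => a'N.
(* A block starting that early would meet block [n] at [p0]. *)
have n'n : n' = n.
  apply: triv => //; exists p0; split=> //; rewrite E' /=.
  rewrite (ltn_trans p0_b b_b') andbT (leq_trans (ltnW a'N)) //.
  by rewrite leq_max leqnn.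
by move: b_b'; rewrite n'n ltnn.
Qed.

(** The gap required between consecutive blocks leaves room, just before each
of them, for a position that belongs to none of them. *)
Lemma interval_partition_gaps (I : (set nat)^nat) :
  interval_partition I ->
  exists n a b : nat^nat,
    [/\ forall k, I (n k) = [set q | (a k <= q < b k)%N],
        forall k, (k <= n k)%N, forall k, (k < a k)%N,
        forall k, (a k < b k)%N & forall k, (b k < a k.+1)%N].
Proof.
move=> Ipart.
have /choice[h hP] N : exists t : nat * nat * nat,
    [/\ (N <= t.1.1)%N, (N <= t.1.2)%N, (t.1.2 < t.2)%N &
        I t.1.1 = [set q | (t.1.2 <= q < t.2)%N]].
  have [n [a [b nab]]] := interval_partition_late _ N Ipart.
  by exists (n, a, b).
pose c := fix c k := if k is j.+1 then (h (c j)).2.+1 else 1%N.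
have kc k : (k < c k)%N.
  elim: k => //= k IHk; have [_ ca ab _] := hP (c k).
  by rewrite ltnS; apply: leq_trans IHk (leq_trans ca (ltnW ab)).
exists (fun k => (h (c k)).1.1), (fun k => (h (c k)).1.2), (fun k => (h (c k)).2).
split=> k; have [cn ca ab E] := hP (c k) => //.
- exact: leq_trans (ltnW (kc k)) cn.
- exact: leq_trans (kc k) ca.
- by have [_ + _ _] := hP (c k.+1).
Qed.

(** The witness copies [y] on a family of blocks with gaps, and at all other
positions encodes [f] with values that dominate [y] up to the end of the next
chosen block. *)
Lemma record_set_not_meager_minus (f : baire_space) : ~ meager_minus (record_set f).
Proof.
move=> [y [I Ipart fy]].
have [n [a [b [IE kn ka ab ba]]]] := interval_partition_gaps _ Ipart.
have b_homo : {homo b : j k / (j <= k)%N}.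
  by apply: homo_leq leq_trans _ => // k; exact: ltnW (ltn_trans (ba k) (ab _)).
(* A chosen block that starts at [p + 1] has an index at most [p], since
   [k < a k]; so it ends by [b p]. *)
have /choice[v vP] p : exists v, behead (CodeSeq.decode v) = mkseq f p /\
    (\max_(q < b p) y q <= v)%N.
  have [v vs Bv] := code_record_large (mkseq f p) (\max_(q < b p) y q).
  by exists v.
pose copied q := `[< exists k, (a k <= q < b k)%N >].
have gap k : ~~ copied (a k).-1.
  apply/asboolPn => -[j /andP[aj bj]].
  have a0 : (0 < a k)%N by apply: leq_ltn_trans (ka k).
  have [jk|kj] := ltnP j k.
    case: k jk a0 aj bj => // k; rewrite ltnS => jk a0 _.
    rewrite ltnNge => /negP; apply; apply: leq_trans (b_homo _ _ jk) _.
    by rewrite -ltnS (prednK a0).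
  have a_homo : {homo a : i l / (i <= l)%N}.
    by apply: homo_leq leq_trans _ => // l; exact: ltnW (ltn_trans (ab l) (ba l)).
  by have := leq_trans (a_homo _ _ kj) aj; rewrite leqNgt ltn_predL a0.
pose x : baire_space := fun q => if copied q then y q else v q.
have fx : record_set f x.
  move=> q; case: (boolP (copied q)) => [qcop|/negbTE qcop]; last first.
    by left; rewrite /x qcop; have [] := vP q.
  right; have /asboolP[k /andP[ak bk]] := qcop.
  have a0 : (0 < a k)%N by apply: leq_ltn_trans (ka k).
  exists (a k).-1; first by rewrite prednK.
  rewrite /x qcop (negbTE (gap k)).
  have [_] := vP (a k).-1; apply: leq_trans.
  have qb : (q < b (a k).-1)%N.
    by apply: leq_trans bk (b_homo _ _ _); rewrite -ltnS prednK.
  exact: (leq_bigmax (Ordinal qb)).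
have [N _ Nfy] := fy _ fx.
apply: (Nfy (n N) (kn N)) => q; rewrite inE IE /= => qN.
by rewrite /x (_ : copied q) //; apply/asboolP; exists N.
Qed.

(** The Baire space has no isolated points. *)
Lemma meager_set1 (x : baire_space) : meager [set x].
Proof.
exists (fun=> [set x]); last by rewrite bigcup_const.
move=> _; apply/seteqP; split=> // z zx.
have [m mx] := nbhs_cylinder zx.
pose y : baire_space := fun i => if (i < m)%N then z i else (x i).+1.
have cy : closure [set x] y by apply: mx => i im; rewrite /y im.
have [_ [-> /(_ m (ltnSn m))]] := cy _ (cylinder_nbhs y m.+1).
by rewrite /y ltnn => /n_Sn.
Qed.

Lemma kappa_le_continuum (T : Type) (kappa : set T) :
  is_add (@meager baire_space) kappa -> (kappa #<= [set: baire_space])%card.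
Proof.
move=> [_ kmin]; apply: card_le_trans (card_image_le (@set1 baire_space) setT).
apply: kmin; split=> [_ [x _ <-]|]; first exact: meager_set1.
rewrite (_ : \bigcup_(S in _) S = setT); first exact: baire_space_nonmeager.
by apply/seteqP; split=> // x _; exists [set x] => //; exists x.
Qed.

Theorem theorem12 (T : Type) (kappa : set T)
    (hkappa : is_add (@meager baire_space) kappa) :
  ~ cc kappa meager_minus.
Proof.
have /pcard_leP/injfunPex[phi _ phi_inj] := kappa_le_continuum _ _ hkappa.
move=> /(_ (fun i => record_set (phi i)))[i _|i [j [ki kj ij]]].
  by split; [exact: borel_record_set | exact: record_set_not_meager_minus].
apply; apply: record_setI_meager_minus => phiE; apply: ij.
by apply: phi_inj phiE; rewrite inE.
Qed.
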